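(* There exists an absolute constant $c>0$ such that for all integers $n\ge 5$, \[ r_4(5,n)\ \ge\ 2^{2^{c\,n^{1/5}}}. \]
   Context: For integers $k<s$ and $n$, the Ramsey number $r_k(s,n)$ is the smallest integer $N$ such that every $k$-uniform hypergraph on $N$ vertices contains either a copy of the complete $k$-uniform hypergraph $K_s^{(k)}$ on $s$ vertices or an independent set of size $n$ (a set of $n$ vertices containing no edge). *)

(* Defs.v *)
From mathcomp Require Import all_boot.
From Stdlib Require Import Reals.
Set Implicit Arguments. Unset Strict Implicit. Unset Printing Implicit Defensive.

Definition uniform (k N : nat) (E : {set {set 'I_N}}) : bool :=
  [forall e in E, #|e| == k].

Definition has_clique (k s N : nat) (E : {set {set 'I_N}}) : Prop :=
  exists S : {set 'I_N}, #|S| = s /\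
    forall e : {set 'I_N}, e \subset S -> #|e| = k -> e \in E.

Definition has_indep (N n : nat) (E : {set {set 'I_N}}) : Prop :=
  exists S : {set 'I_N}, #|S| = n /\
    forall e : {set 'I_N}, e \in E -> ~~ (e \subset S).

Definition ramsey_prop (k s n N : nat) : Prop :=
  forall E : {set {set 'I_N}}, uniform k E -> has_clique k s E \/ has_indep n E.

(* "r_k(s,n) >= M" (r_k(s,n) being the least N with ramsey_prop):
   every N with the Ramsey property is at least M. *)
Definition ramsey_ge (k s n : nat) (M : R) : Prop :=
  forall N : nat, ramsey_prop k s n N -> (M <= INR N)%R.

(* Main.v *)
Require Import Defs.
From mathcomp Require Import all_boot zify.
Set Implicit Arguments. Unset Strict Implicit. Unset Printing Implicit Defensive.

(* Idea.  This is a stepping-up construction.  For naturals x < y let delta x y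
   be the position (counted from 1) of the highest bit where they differ.  A finite set S of
   naturals spans a binary tree whose leaves are S and whose branching nodes are
   labelled by the values of delta, labels decreasing downwards.  Colour the
   pairs of labels at random with two colours.  A quadruple of leaves spans a
   tree with three branching nodes; it is never an edge when two of these are
   incomparable, and otherwise they form a path t > u > v that makes two turns
   (each left or right), and the quadruple is an edge according to the colours
   of tu, uv, tv and the two turns.  The rule is chosen so that no five leaves
   have all their quadruples as edges.

   Let S be independent.  A path with m turns in the same direction would give an
   edge inside S by randomness, even with exponentially (in m) many labels; so
   the height of the tree is O(m).  A path making six alternating turns also
   gives an edge, whatever the colouring.  A tree of height less than
   L whose paths avoid a given word of k turns has at most L^k leaves, so each
   of the two subtrees at the root, which avoids an alternating word of five
   turns, has O(m^5) leaves. *)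

(** * The highest differing bit *)

Lemma agree_ex x y : exists s, x %/ 2 ^ s == y %/ 2 ^ s.
Proof.
exists (x + y).
have lt_exp n m : n < 2 ^ (n + m).
  by rewrite (leq_trans (ltn_expl n (ltnSn 1))) ?leq_exp2l ?leq_addr.
by rewrite !divn_small // [x + y]addnC.
Qed.

Definition delta x y := ex_minn (agree_ex x y).

Lemma delta_le x y s : (delta x y <= s) = (x %/ 2 ^ s == y %/ 2 ^ s).
Proof.
rewrite /delta; case: ex_minnP => m /eqP eqm minm.
apply/idP/idP => [/subnK <-|]; last exact: minm.
by rewrite addnC expnD !divnMA eqm.
Qed.

Lemma delta_small D x y : x < 2 ^ D -> y < 2 ^ D -> delta x y <= D.
Proof. by move=> ltx lty; rewrite delta_le !divn_small. Qed.

(** Quotients by [2 ^ s] are monotone, so [x] and [z] have the same quotient exactly when both share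
    it with [y], which lies between them. *)
Lemma delta_max x y z : x < y -> y < z ->
  delta x z = maxn (delta x y) (delta y z).
Proof.
move=> ltxy ltyz.
have eqP' s : (delta x z <= s) = (maxn (delta x y) (delta y z) <= s).
  rewrite geq_max !delta_le.
  have lexy : x %/ 2 ^ s <= y %/ 2 ^ s by apply/leq_div2r/ltnW.
  have leyz : y %/ 2 ^ s <= z %/ 2 ^ s by apply/leq_div2r/ltnW.
  by lia.
by apply/eqP; rewrite eqn_leq eqP' leqnn -eqP' leqnn.
Qed.

(** A common value [s.+1] would give three distinct quotients by [2 ^ s] with the same half, but
    only two numbers have a given half. *)
Lemma delta_neq x y z : x < y -> y < z -> delta x y != delta y z.
Proof.
move=> ltxy ltyz; apply/negP => /eqP eqd.
case def_s: (delta x y) => [|s].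
  have : x %/ 2 ^ 0 == y %/ 2 ^ 0 by rewrite -delta_le def_s.
  by rewrite expn0 !divn1 => /eqP eqxy; rewrite eqxy ltnn in ltxy.
have /eqP eqxy : x %/ 2 ^ s.+1 == y %/ 2 ^ s.+1 by rewrite -delta_le def_s.
have /eqP eqyz : y %/ 2 ^ s.+1 == z %/ 2 ^ s.+1 by rewrite -delta_le -eqd def_s.
have neqxy : x %/ 2 ^ s != y %/ 2 ^ s by rewrite -delta_le def_s ltnn.
have neqyz : y %/ 2 ^ s != z %/ 2 ^ s by rewrite -delta_le -eqd def_s ltnn.
have lexy : x %/ 2 ^ s <= y %/ 2 ^ s by apply/leq_div2r/ltnW.
have leyz : y %/ 2 ^ s <= z %/ 2 ^ s by apply/leq_div2r/ltnW.
move: eqxy eqyz; rewrite expnSr !divnMA; lia.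
Qed.

(** * The colouring rule for quadruples *)

Section RedTriples.
Variable phi : nat -> nat -> bool.

Definition mono_red t u v := [&& ~~ phi t u, ~~ phi u v & phi t v].
(** Here [&&] binds tighter than [!=]: the colour of [uv] is compared with the conjunction of the
    other two. *)
Definition lr_red t u v := phi u v != phi t u && phi t v.
Definition rl_red t u v := if phi t u then phi t v && phi u v else ~~ phi u v.

(* For x1 < x2 < x3 < x4 with consecutive deltas [a], [b], [c]: the order of [a],
   [b], [c] determines the shape of the tree on the four leaves.  Monotone triples
   are paths turning twice left or twice right, a local maximum [b] is never red,
   and a local minimum gives a left-right path if [a < c], a right-left path
   otherwise. *)
Definition red a b c :=
  if a < b then (b < c) && mono_red c b a
  else if c < b then mono_red a b c
  else if a < c then lr_red c a b else rl_red a c b.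

(** The numbers [a], [b], [c], [d] stand for the consecutive deltas of five leaves. Dropping an
    inner leaf replaces two neighbours by their maximum, so the five terms are the five quadruples.
    The proof exhausts orders and colours. *)
Lemma no_red_five a b c d :
    a != b -> b != c -> c != d -> maxn a b != c -> maxn b c != d ->
  ~~ [&& red a b c, red b c d, red (maxn a b) c d, red a (maxn b c) d
       & red a b (maxn c d)].
Proof.
rewrite /red /maxn => neab nebc necd neabc nebcd; apply/negP.
move: neab nebc necd neabc nebcd.
case: (ltngtP a b) => ltab //; case: (ltngtP b c) => ltbc //;
  case: (ltngtP c d) => ltcd //= _ _ _.
all: move=> neac nebd; rewrite /mono_red /lr_red /rl_red;
  repeat match goal with |- context [?x < ?y] =>
    case: (ltnP x y) => ? //=; try lia end;
  repeat match goal with |- context [phi ?x ?y] => case: (phi x y) end;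
  rewrite ?andbF //=.
Qed.
End RedTriples.

(** * Binary trees and the turns along their paths *)

Inductive tree := Leaf of nat | Node of nat & tree & tree.

Fixpoint leaves T :=
  match T with Leaf x => [:: x] | Node _ X Y => leaves X ++ leaves Y end.

Fixpoint height T :=
  match T with Leaf _ => 0 | Node _ X Y => (maxn (height X) (height Y)).+1 end.

(* Directions are booleans: [false] stands for left and [true] for right. *)
Fixpoint turns d T :=
  match T with
  | Leaf _ => 0
  | Node _ X Y => maxn (~~ d + turns d X) (d + turns d Y)
  end.

Definition is_node T := if T is Node _ _ _ then true else false.
Definition label T := if T is Node t _ _ then t else 0.
Definition child (d : bool) T :=
  if T is Node _ X Y then if d then Y else X else T.

Fixpoint occurs U T :=
  U = T \/ match T with Leaf _ => False | Node _ X Y => occurs U X \/ occurs U Y end.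

Lemma occurs_refl T : occurs T T.
Proof. by case: T; left. Qed.

Lemma occurs_child d T : occurs (child d T) T.
Proof. by case: T d => [x|t X Y] [] /=; auto using occurs_refl. Qed.

Lemma occurs_trans V U T : occurs U V -> occurs V T -> occurs U T.
Proof.
move=> UV; elim: T => [x|t X IHX Y IHY] /= [VT|] //.
- by move: UV; rewrite VT.
- by move: UV; rewrite VT.
- by case=> [/IHX|/IHY]; auto.
Qed.

Definition below d U V := is_node V /\ occurs V (child d U).

Lemma below_occurs d U V T : below d U V -> occurs U T -> occurs V T.
Proof. by case=> _ VU UT; apply/(occurs_trans VU)/(occurs_trans (occurs_child d U)). Qed.

Lemma height_child d T : height (child d T) <= height T.
Proof. by case: T d => [x|t X Y] [] //=; lia. Qed.

Lemma height_occurs U T : occurs U T -> height U <= height T.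
Proof.
elim: T => [x|t X IHX Y IHY] /= [-> //|] //.
by case=> [/IHX|/IHY]; lia.
Qed.

Lemma height_turns T : height T <= turns false T + turns true T.
Proof. by elim: T => [x|t X IHX Y IHY] //=; lia. Qed.

Lemma leaves_gt0 T : 0 < size (leaves T).
Proof. by elim: T => [x|t X IHX Y IHY] //=; rewrite size_cat; lia. Qed.

(** Walk down from the root, always away from a child with at most [K] leaves: each step loses at
    most [K] leaves, and one leaf remains at the end. *)
Lemma size_leaves_slim K T :
    (forall U, occurs U T -> is_node U -> exists d, size (leaves (child d U)) <= K) ->
  size (leaves T) <= height T * K + 1.
Proof.
elim: T => [x|t X IHX Y IHY] //= slimT; rewrite size_cat mulSn.
have leX : height X * K <= maxn (height X) (height Y) * K by rewrite leq_mul ?leq_maxl.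
have leY : height Y * K <= maxn (height X) (height Y) * K by rewrite leq_mul ?leq_maxr.
have {}IHX := IHX (fun U UX => slimT U (or_intror (or_introl UX))).
have {}IHY := IHY (fun U UY => slimT U (or_intror (or_intror UY))).
by case: (slimT _ (or_introl erefl) isT) => -[] /=; lia.
Qed.

(** A word of [k] letters asks for [k + 1] nodes: the empty word still requires an internal node. *)
Fixpoint has_chain w T :=
  exists U, [/\ occurs U T, is_node U
    & match w with [::] => True | d :: w' => has_chain w' (child d U) end].

(** If the word is [d :: w], the [d]-child of every node avoids [w], since the node would complete a
    chain there. By induction that child has at most [K = h.+1 ^ size w] leaves, and the walk bound
    [h * K + 1] is at most [h.+1 * K]. *)
Lemma size_leaves_no_chain h w T :
  height T <= h -> ~ has_chain w T -> size (leaves T) <= h.+1 ^ size w.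
Proof.
elim: w T => [|d w IHw] T leTh noT.
  case: T noT leTh => [x|t X Y] // noT; case: noT.
  by exists (Node t X Y); split=> //; left.
rewrite expnS mulSn addnC.
apply: leq_trans (size_leaves_slim (K := h.+1 ^ size w) _) _; last first.
  by rewrite leq_add ?leq_mul ?expn_gt0.
move=> U UT nU; exists d; apply: IHw.
  by rewrite (leq_trans (height_child _ _)) ?(leq_trans (height_occurs UT)).
by move=> chU; apply: noT; exists U.
Qed.

Fixpoint straight d (s : seq nat) T :=
  if s is t :: s' then
    exists U, [/\ occurs U T, is_node U, label U = t & straight d s' (child d U)]
  else True.

Lemma straight_occurs d s U T : occurs U T -> straight d s U -> straight d s T.
Proof.
case: s => [|t s] //= UT [V [VU nV lV sV]]; exists V; split=> //.
exact: occurs_trans UT.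
Qed.

(** In a constant direction, being below is transitive, so nodes of the path may be skipped. *)
Lemma straight_subseq d s1 s2 T : subseq s1 s2 -> straight d s2 T -> straight d s1 T.
Proof.
elim: s2 s1 T => [|t s2 IHs] [|u s1] T //=.
have [-> sub12 | _ sub12] := eqVneq u t => -[U [UT nU lU sU]].
  by exists U; split=> //; apply: IHs sU.
have := IHs _ _ sub12 sU; apply: straight_occurs.
exact: occurs_trans (occurs_child d U) UT.
Qed.

Lemma straight_turns d T : exists2 s, size s = turns d T & straight d s T.
Proof.
elim: T => [x|t X [sX szX stX] Y [sY szY stY]]; first by exists [::].
case: d szX stX szY stY => /= szX stX szY stY.
- have [lt_YX|le_XY] := ltnP (turns true Y) (turns true X).
    exists sX; first by rewrite szX; lia.
    by apply: straight_occurs stX; right; left; apply: occurs_refl.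
  exists (t :: sY); first by rewrite /= szY; lia.
  by exists (Node t X Y); split=> //; left.
- have [lt_XY|le_YX] := ltnP (turns false X) (turns false Y).
    exists sY; first by rewrite szY; lia.
    by apply: straight_occurs stY; right; right; apply: occurs_refl.
  exists (t :: sX); first by rewrite /= szX; lia.
  by exists (Node t X Y); split=> //; left.
Qed.

(* [c i j] is the colour of the i-th and j-th labels on a path of seven nodes
   turning alternately, left at the nodes [i] with [odd i = d].  The hypothesis
   says that none of its left-right and right-left triples is red. *)
Lemma no_alternating (d : bool) (c : nat -> nat -> bool) :
    (forall i j k, i < j < k -> k < 7 -> odd i != odd j ->
       if odd i == d then c j k = c i j && c i k
       else if c i j then c i k -> c j k = false else c j k) ->
  False.
Proof.
move=> rule.
have r i j k (ltijk : [&& i < j < k, k < 7 & odd i != odd j]) :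
    if odd i == d then c j k == c i j && c i k
    else if c i j then c i k ==> ~~ c j k else c j k.
  case/and3P: ltijk => ltij ltk oij; move: (rule i j k ltij ltk oij).
  case: (odd i == d) => [->//|]; case: (c i j) => //.
  by case: (c i k) => //= ->.
(* These are all the triples below 7 with [i] and [j] of opposite parity. What follows is a search
   over the 21 colours, pruned as soon as a rule fails. *)
have r012 := r 0 1 2 isT. have r013 := r 0 1 3 isT. have r014 := r 0 1 4 isT.
have r015 := r 0 1 5 isT. have r016 := r 0 1 6 isT. have r034 := r 0 3 4 isT.
have r035 := r 0 3 5 isT. have r036 := r 0 3 6 isT. have r056 := r 0 5 6 isT.
have r123 := r 1 2 3 isT. have r124 := r 1 2 4 isT. have r125 := r 1 2 5 isT.
have r126 := r 1 2 6 isT. have r145 := r 1 4 5 isT. have r146 := r 1 4 6 isT.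
have r234 := r 2 3 4 isT. have r235 := r 2 3 5 isT. have r236 := r 2 3 6 isT.
have r256 := r 2 5 6 isT. have r345 := r 3 4 5 isT. have r346 := r 3 4 6 isT.
have r456 := r 4 5 6 isT.
clear r rule.
case: d r012 r013 r014 r015 r016 r034 r035 r036 r056 r123 r124 r125 r126 r145
  r146 r234 r235 r236 r256 r345 r346 r456 => /=.
all: case: (c 0 1); case: (c 0 2); case: (c 0 3); case: (c 0 4); case: (c 0 5);
  case: (c 0 6) => /=; case: (c 1 2) => //=; case: (c 1 3) => //=;
  case: (c 1 4) => //=; case: (c 1 5) => //=; case: (c 1 6) => //=;
  case: (c 3 4) => //=; case: (c 3 5) => //=; case: (c 3 6) => //=;
  case: (c 5 6) => //=; case: (c 2 3) => //=; case: (c 2 4) => //=;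
  case: (c 2 5) => //=; case: (c 2 6) => //=; case: (c 4 5) => //=;
  by case: (c 4 6).
Qed.

(** * Trees labelled by [delta] *)

Fixpoint well_labelled T :=
  match T with
  | Leaf _ => True
  | Node t X Y => [/\ well_labelled X, well_labelled Y
      & {in leaves X & leaves Y, forall x y, x < y /\ delta x y = t}]
  end.

Lemma well_occurs U T : occurs U T -> well_labelled T -> well_labelled U.
Proof.
elim: T => [x|t X IHX Y IHY] /= [-> //|] //.
by case=> UT [wX wY _]; auto.
Qed.

Lemma leaves_occurs U T : occurs U T -> {subset leaves U <= leaves T}.
Proof.
elim: T => [x|t X IHX Y IHY] /= [-> //|] //.
by case=> [/IHX|/IHY] sub z /sub; rewrite mem_cat => ->; rewrite ?orbT.
Qed.

Lemma leaf_ex T : exists x, x \in leaves T.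
Proof. by case: (leaves T) (leaves_gt0 T) => // x s _; exists x; rewrite mem_head. Qed.

Lemma well_node t X Y T : occurs (Node t X Y) T -> well_labelled T ->
  {in leaves X & leaves Y, forall x y, x < y /\ delta x y = t}.
Proof. by move=> occ /(well_occurs occ) []. Qed.

(** Compare two leaves split by [V] with a leaf on the other side of [U]: the larger of the two
    labels is that of [U], by [delta_max], and the labels differ, by [delta_neq]. *)
Lemma label_below d U V : is_node U -> well_labelled U -> below d U V -> label V < label U.
Proof.
case: U => [|t X Y] // _ wU []; case: V => [|u X2 Y2] // _ /= occ.
have [x xX] := leaf_ex X; have [y yY] := leaf_ex Y.
have [x2 x2X] := leaf_ex X2; have [y2 y2Y] := leaf_ex Y2.
have sub := leaves_occurs occ; case: wU => wX wY wXY.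
have x2V : x2 \in leaves (Node u X2 Y2) by rewrite /= mem_cat x2X.
have y2V : y2 \in leaves (Node u X2 Y2) by rewrite /= mem_cat y2Y orbT.
case: d occ sub => /= occ sub.
- have [lt22 d22] := well_node occ wY x2X y2Y.
  have [lt_xx2 d_xx2] := wXY _ _ xX (sub _ x2V).
  have [lt_xy2 d_xy2] := wXY _ _ xX (sub _ y2V).
  have := delta_neq lt_xx2 lt22; have := delta_max lt_xx2 lt22.
  by rewrite d_xx2 d_xy2 d22; lia.
- have [lt22 d22] := well_node occ wX x2X y2Y.
  have [lt_x2y d_x2y] := wXY _ _ (sub _ x2V) yY.
  have [lt_y2y d_y2y] := wXY _ _ (sub _ y2V) yY.
  have := delta_neq lt22 lt_y2y; have := delta_max lt22 lt_y2y.
  by rewrite d_x2y d_y2y d22; lia.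
Qed.

Section TreeTurns.
Variable phi : nat -> nat -> bool.

Definition no_red (s : seq nat) :=
  forall v1 v2 v3 v4, v1 \in s -> v2 \in s -> v3 \in s -> v4 \in s ->
  v1 < v2 -> v2 < v3 -> v3 < v4 ->
  ~~ red phi (delta v1 v2) (delta v2 v3) (delta v3 v4).

Definition turn_red (d d' : bool) :=
  if d == d' then mono_red phi else if d' then lr_red phi else rl_red phi.

(** The witnesses are two leaves split by [W], one from the side of [V] away from [W] and one from
    the side of [U] away from [V]. In increasing order, their consecutive deltas are the three
    labels, arranged so that [red] selects the rule for [d] and [d']. *)
Lemma turn_not_red d d' U V W T :
    well_labelled T -> no_red (leaves T) -> occurs U T -> is_node U ->
    below d U V -> below d' V W ->
  ~~ turn_red d d' (label U) (label V) (label W).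
Proof.
move=> wT nrT UT nU bUV bVW.
have VT := below_occurs bUV UT; have WT := below_occurs bVW VT.
have nV : is_node V by case: bUV.
have ltVU := label_below nU (well_occurs UT wT) bUV.
have ltWV := label_below nV (well_occurs VT wT) bVW.
have subU := leaves_occurs UT; have subV := leaves_occurs VT.
have subW := leaves_occurs WT.
have wU := well_occurs UT wT; have wV := well_occurs VT wT; have wW := well_occurs WT wT.
case: U nU UT bUV ltVU subU wU => // t X Y _ UT [_ occV] /= ltVU subU [_ _ wU].
case: V nV VT bVW occV ltVU ltWV subV wV => // u X2 Y2 _ VT [nW occW] occV /= ltVU ltWV subV.
move=> [_ _ wV].
case: W nW WT occW ltWV subW wW => // v X3 Y3 _ WT occW /= ltWV subW [_ _ wW].
have [x3 x3X] := leaf_ex X3; have [y3 y3Y] := leaf_ex Y3.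
have inW z : z \in leaves X3 \/ z \in leaves Y3 -> z \in leaves (Node v X3 Y3).
  by rewrite /= mem_cat => -[->|->]; rewrite ?orbT.
have inV z : z \in leaves X2 \/ z \in leaves Y2 -> z \in leaves (Node u X2 Y2).
  by rewrite /= mem_cat => -[->|->]; rewrite ?orbT.
have lU z : z \in leaves X -> z \in leaves T by move=> zX; apply: subU; rewrite mem_cat zX.
have rU z : z \in leaves Y -> z \in leaves T by move=> zY; apply: subU; rewrite mem_cat zY orbT.
have VU z : z \in leaves (Node u X2 Y2) -> z \in leaves T by apply: subV.
have WU z : z \in leaves (Node v X3 Y3) -> z \in leaves T by apply: subW.
have subVU := leaves_occurs occV; have subWV := leaves_occurs occW.
have [lt3 d3] := wW _ _ x3X y3Y.
have x3W : x3 \in leaves (Node v X3 Y3) by apply: inW; left.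
have y3W : y3 \in leaves (Node v X3 Y3) by apply: inW; right.
case: d' occW subWV => /= occW subWV.
- have [x2 x2X] := leaf_ex X2; have x2V : x2 \in leaves (Node u X2 Y2) by apply: inV; left.
  have [lt2 d2] := wV _ _ x2X (subWV _ x3W).
  have y3V : y3 \in leaves (Node u X2 Y2) by apply: inV; right; apply: subWV.
  case: d occV subVU => /= occV subVU.
  + have [x xX] := leaf_ex X; have [lt1 d1] := wU _ _ xX (subVU _ x2V).
    have := nrT x x2 x3 y3 (lU _ xX) (VU _ x2V) (WU _ x3W) (WU _ y3W) lt1 lt2 lt3.
    by rewrite d1 d2 d3 /red ltnNge (ltnW ltVU) /= ltWV.
  + have [y yY] := leaf_ex Y; have [lt1 d1] := wU _ _ (subVU _ y3V) yY.
    have := nrT x2 x3 y3 y (VU _ x2V) (WU _ x3W) (WU _ y3W) (rU _ yY) lt2 lt3 lt1.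
    by rewrite d1 d2 d3 /red ltnNge (ltnW ltWV) /= ltVU ltnNge (ltnW (ltn_trans ltWV ltVU)).
- have [y2 y2Y] := leaf_ex Y2; have y2V : y2 \in leaves (Node u X2 Y2) by apply: inV; right.
  have [lt2 d2] := wV _ _ (subWV _ y3W) y2Y.
  have x3V : x3 \in leaves (Node u X2 Y2) by apply: inV; left; apply: subWV.
  case: d occV subVU => /= occV subVU.
  + have [x xX] := leaf_ex X; have [lt1 d1] := wU _ _ xX (subVU _ x3V).
    have := nrT x x3 y3 y2 (lU _ xX) (WU _ x3W) (WU _ y3W) (VU _ y2V) lt1 lt3 lt2.
    by rewrite d1 d2 d3 /red !ltnNge (ltnW (ltn_trans ltWV ltVU)) (ltnW ltWV) (ltnW ltVU) /= .
  + have [y yY] := leaf_ex Y; have [lt1 d1] := wU _ _ (subVU _ y2V) yY.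
    have := nrT x3 y3 y2 y (WU _ x3W) (WU _ y3W) (VU _ y2V) (rU _ yY) lt3 lt2 lt1.
    by rewrite d1 d2 d3 /red ltWV ltVU.
Qed.
End TreeTurns.

Lemma chain_nodes w T : has_chain w T ->
  exists U : nat -> tree,
    (forall i, i <= size w -> occurs (U i) T /\ is_node (U i)) /\
    (forall i j, i < j <= size w -> below (nth false w i) (U i) (U j)).
Proof.
elim: w T => [|d w IHw] T /= [V [VT nV chV]].
  by exists (fun=> V); split=> // i j; lia.
have [U [occU belU]] := IHw _ chV.
exists (fun i => if i is i'.+1 then U i' else V); split=> [[|i] // lei|[|i] [|j] //= leij].
- have [occ nU] := occU i lei; split=> //.
  by apply/(occurs_trans occ)/(occurs_trans (occurs_child d V)).
- by have [occ nU] := occU j leij.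
- exact: belU.
Qed.

(** * Size of the tree of an independent set *)

Section IndependentTree.
Variables (phi : nat -> nat -> bool) (m M : nat).

Definition mono_dense := forall s, sorted gtn s -> all (gtn M) s -> m <= size s ->
  exists t u v, subseq [:: t; u; v] s /\ mono_red phi t u v.

Lemma straight_sorted d s T : well_labelled T -> straight d s T -> sorted gtn s.
Proof.
elim: s T => [|t s IHs] // T wT /= [U [UT nU <- stU]].
have wU := well_occurs UT wT.
have wC := well_occurs (occurs_child d U) wU.
have := IHs _ wC stU; case: s stU {IHs} => [|u s] //= [V [VU nV <- _]] ->.
by rewrite andbT; apply: (label_below nU wU (d := d)).
Qed.

Lemma straight_labels d s T : well_labelled T ->
  {in leaves T, forall x, x < 2 ^ M.-1} -> 0 < M -> straight d s T -> all (gtn M) s.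
Proof.
move=> wT ltT M0; elim: s T wT ltT => [|t s IHs] // T wT ltT /= [U [UT nU <- stU]].
have CT : occurs (child d U) T := occurs_trans (occurs_child d U) UT.
rewrite (IHs (child d U)) //; first last.
- by move=> x /(leaves_occurs CT)/ltT.
- exact: well_occurs CT wT.
have subU := leaves_occurs UT; have := well_occurs UT wT.
case: U nU subU {UT stU CT} => // {}t X Y _ sub /= [_ _ wXY]; rewrite andbT.
have [x xX] := leaf_ex X; have [y yY] := leaf_ex Y; have [_ <-] := wXY _ _ xX yY.
(* Leaves below [2 ^ M.-1] only give labels up to [M.-1], hence below [M]. *)
suff: delta x y <= M.-1 by lia.
by apply: delta_small; apply/ltT/sub; rewrite mem_cat ?xX ?yY ?orbT.
Qed.

Variable T : tree.
Hypotheses (wT : well_labelled T) (nrT : no_red phi (leaves T)).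

Lemma turns_lt d : mono_dense -> {in leaves T, forall x, x < 2 ^ M.-1} -> 0 < M ->
  turns d T < m.
Proof.
move=> dense ltT M0; rewrite ltnNge; apply/negP => le_m.
have [s szs sts] := straight_turns d T.
have [||t [u [v [sub mono]]]] := dense s (straight_sorted wT sts).
- exact: straight_labels sts.
- by rewrite szs.
have [U [UT nU lU [V [VU nV lV [W [WV nW lW _]]]]]] := straight_subseq sub sts.
have := turn_not_red wT nrT UT nU (conj nV VU) (conj nW WV).
by rewrite /turn_red eqxx lU lV lW mono.
Qed.

(** Six letters give seven nodes, and the letter [odd i (+) d] means left exactly when [odd i = d],
    as [no_alternating] expects. *)
Lemma no_alternating_chain d : ~ has_chain (mkseq (fun i => odd i (+) d) 6) T.
Proof.
move=> /chain_nodes [U []]; rewrite size_mkseq => occU belU.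
apply: (@no_alternating d (fun i j => phi (label (U i)) (label (U j)))) => i j k.
move=> /andP[ltij ltjk] ltk neq_odd.
have [UiT nUi] : occurs (U i) T /\ is_node (U i) by apply: occU; lia.
have := belU i j; rewrite ltij nth_mkseq; last by lia.
have := belU j k; rewrite ltjk nth_mkseq; last by lia.
move=> /(_ ltk) bjk /(_ ltac:(lia)) bij.
have bad := turn_not_red wT nrT UiT nUi bij bjk.
move: bad; rewrite /turn_red /lr_red /rl_red; clear -neq_odd.
case: (odd i) (odd j) d neq_odd => -[] [] //= _;
  case: (phi (label (U i)) (label (U j))) => //=;
  case: (phi (label (U i)) (label (U k))) => //=;
  by case: (phi (label (U j)) (label (U k))).
Qed.

Lemma size_leaves_le : mono_dense -> {in leaves T, forall x, x < 2 ^ M.-1} -> 0 < M ->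
  size (leaves T) <= 2 * (2 * m) ^ 5.
Proof.
move=> dense ltT M0.
have ltl := turns_lt false dense ltT M0.
have ltr := turns_lt true dense ltT M0.
have leH := height_turns T.
have bound d : size (leaves (child d T)) <= (2 * m) ^ 5.
  have [nT|lT] := boolP (is_node T); last first.
    by case: (T) lT => [x|//] _ /=; rewrite expn_gt0; apply/orP; left; lia.
  (* Both values of [turns] are below [m], so the height is at most [(2 * m).-1]. *)
  have -> : 2 * m = (2 * m).-1.+1 by lia.
  (* The five letters start opposite to [d]; the root and its turn [d] complete them to six
     alternating letters. Passing to the children thus lowers the exponent from 6 to 5. *)
  apply: (@size_leaves_no_chain _ (mkseq (fun i => odd i (+) ~~ d) 5)).
    by have := height_child d T; lia.
  move=> chC; apply: (@no_alternating_chain d).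
  by exists T; split; [exact: occurs_refl | | case: d chC].
move: ((2 * m) ^ 5) bound => B bound.
have := bound true; have := bound false.
by case: (T) => [x|t X Y] /=; rewrite ?size_cat; lia.
Qed.
End IndependentTree.

(** Induction on the number of bits: the highest bit left undecided cuts the sorted list into two
    halves, which become the subtrees of a node. If one half is empty there is no branching and no
    node is created. *)
Lemma tree_of_sorted d (s : seq nat) : s != [::] -> sorted ltn s ->
  {in s &, forall x y, x %/ 2 ^ d = y %/ 2 ^ d} ->
  exists T, well_labelled T /\ leaves T = s.
Proof.
elim: d s => [|d IHd] s s0 srt eqs.
  case: s s0 srt eqs => [|x [|y s]] // _ srt eqs; first by exists (Leaf x).
  have := eqs x y (mem_head _ _); rewrite !inE eqxx orbT => /(_ isT).
  by rewrite expn0 !divn1 => eqxy; move: srt; rewrite /= eqxy ltnn.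
pose p x := ~~ odd (x %/ 2 ^ d); pose s1 := filter p s; pose s2 := filter (predC p) s.
have halfE x y : x \in s -> y \in s -> (x %/ 2 ^ d) %/ 2 = (y %/ 2 ^ d) %/ 2.
  by move=> xs ys; rewrite -!divnMA -expnSr; apply: eqs.
have lt12 x y : x \in s1 -> y \in s2 -> x < y /\ delta x y = d.+1.
  rewrite !mem_filter /p /= negbK => /andP[ox xs] /andP[oy ys].
  have eq2 := halfE _ _ xs ys.
  have ltd : x %/ 2 ^ d < y %/ 2 ^ d by lia.
  split; first by rewrite ltnNge; apply: contraL ltd => leyx; rewrite -leqNgt leq_div2r.
  by apply/eqP; rewrite eqn_leq delta_le ltnNge delta_le (eqs _ _ xs ys) eqxx neq_ltn ltd.
have srt1 : sorted ltn s1 by apply: sorted_filter srt; apply: ltn_trans.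
have srt2 : sorted ltn s2 by apply: sorted_filter srt; apply: ltn_trans.
have def_s : s = s1 ++ s2.
  apply: (irr_sorted_eq ltn_trans ltnn srt).
    have -> : sorted ltn (s1 ++ s2) = sorted ltn s1 && sorted ltn s2.
      case: s1 srt1 lt12 => [|x s1] //= srt1 lt12; rewrite cat_path srt1 /=.
      case: s2 srt2 lt12 => [|y s2] //= srt2 lt12.
      by case: (lt12 (last x s1) y) => [||-> _ //]; rewrite ?mem_last ?mem_head.
    by rewrite srt1.
  by move=> x; rewrite mem_cat !mem_filter /= -andb_orl orbN.
have half (r : pred nat) (q : bool) : (forall x, r x -> odd (x %/ 2 ^ d) = q) ->
    {in filter r s &, forall x y, x %/ 2 ^ d = y %/ 2 ^ d}.
  move=> rq x y; rewrite !mem_filter => /andP[/rq ox xs] /andP[/rq oy ys].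
  by have := halfE _ _ xs ys; lia.
have IH1 := IHd s1 _ srt1 (half p false _); have IH2 := IHd s2 _ srt2 (half (predC p) true _).
have [s1_0|s1n0] := eqVneq s1 [::].
  rewrite def_s s1_0; apply: IH2; last by move=> x; rewrite /p /= negbK.
  by move: s0; rewrite def_s s1_0.
have [s2_0|s2n0] := eqVneq s2 [::].
  rewrite def_s s2_0 cats0; apply: IH1 => // x; exact: negbTE.
have [|T1 [w1 l1]] := IH1 s1n0; first by move=> x; apply: negbTE.
have [|T2 [w2 l2]] := IH2 s2n0; first by move=> x; rewrite /p /= negbK.
exists (Node d.+1 T1 T2); rewrite /= l1 l2; split; last exact: esym def_s.
by split=> // x y; apply: lt12.
Qed.

(** * Counting the functions that avoid disjoint patterns *)

Section Avoidance.
Variable I : finType.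
Implicit Types (phi : {ffun I -> bool}) (e : I * I * I).

Definition hits phi e := [&& ~~ phi e.1.1, ~~ phi e.1.2 & phi e.2].
Definition edges e := [:: e.1.1; e.1.2; e.2].
Definition avoiders (L : seq (I * I * I)) := [set phi | all (fun e => ~~ hits phi e) L].

Definition force e phi : {ffun I -> bool} :=
  [ffun x => if x == e.2 then true else if x \in edges e then false else phi x].

(* Resetting the three values on [e] to the avoided pattern forgets 3 bits, so at
   least 1/8 of the functions avoiding [L] hit [e]. *)
Lemma card_avoiders_cons e L : uniq (edges e) ->
    all (fun e' => ~~ has [in edges e] (edges e')) L ->
  #|avoiders (e :: L)| * 8 <= #|avoiders L| * 7.
Proof.
move=> uniq_e disj.
pose H := avoiders L :\: avoiders (e :: L).
have subA : avoiders (e :: L) \subset avoiders L.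
  by apply/subsetP => phi; rewrite !inE /= => /andP[].
suff le8 : #|avoiders L| <= #|H| * 8.
  have := cardsID (avoiders (e :: L)) (avoiders L).
  by rewrite (setIidPr subA) -/H; lia.
pose g phi := (force e phi, (phi e.1.1, phi e.1.2, phi e.2)).
have inj_g : injective g.
  move=> f1 f2 [eqf eq1 eq2 eq3]; apply/ffunP => x.
  have [xe|xe] := boolP (x \in edges e).
    by move: xe; rewrite !inE => /or3P[] /eqP ->.
  have := congr1 (fun f : {ffun I -> bool} => f x) eqf; rewrite !ffunE (negPf xe).
  by case: eqP xe => // ->; rewrite !inE eqxx !orbT.
rewrite -(card_imset _ inj_g).
have -> : #|H| * 8 = #|setX H [set: bool * bool * bool]|.
  by rewrite cardsX cardsT !card_prod card_bool.
apply/subset_leq_card/subsetP => _ /imsetP[phi avL ->]; rewrite !inE andbT /=.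
have -> : hits (force e phi) e.
  move: uniq_e; rewrite /edges /= !inE negb_or /hits !ffunE !inE !eqxx !orbT /=.
  by case/and3P=> /andP[_ /negPf ->] /negPf -> _.
rewrite /=; apply/allP => e' e'L; rewrite inE in avL.
have := allP avL _ e'L; have /hasPn notin := allP disj _ e'L.
have same x : x \notin edges e -> force e phi x = phi x.
  move=> xe; rewrite ffunE (negPf xe); case: eqP => // eqx.
  by move: xe; rewrite eqx !inE eqxx !orbT.
by rewrite /hits !same //; apply: notin; rewrite !inE eqxx ?orbT.
Qed.

Lemma card_avoiders (L : seq (I * I * I)) :
    all (fun e => uniq (edges e)) L ->
    pairwise (fun e e' => ~~ has [in edges e] (edges e')) L ->
  #|avoiders L| * 8 ^ size L <= 2 ^ #|I| * 7 ^ size L.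
Proof.
elim: L => [|e L IHL] /= => [_ _|/andP[uniq_e uniqL] /andP[disj disjL]].
  by rewrite !expn0 !muln1 (leq_trans (max_card _)) // card_ffun card_bool.
have := card_avoiders_cons uniq_e disj.
rewrite -(leq_pmul2r (expn_gt0 8 (size L))) ?expn_gt0 // => le1.
rewrite !expnS !mulnA (leq_trans le1) // mulnAC [leqRHS]mulnAC leq_mul2r.
by rewrite IHL.
Qed.
End Avoidance.

Lemma card_bigcup_le (J T : finType) (P : pred J) (F : J -> {set T}) :
  #|\bigcup_(i | P i) F i| <= \sum_(i | P i) #|F i|.
Proof.
elim/big_ind2: _ => [|A a B b leA leB|//]; first by rewrite cards0.
by rewrite (leq_trans (leq_card_setU _ _)) ?leq_add.
Qed.

Lemma subseq_sorted_subset (s1 s2 : seq nat) : sorted ltn s1 -> sorted ltn s2 ->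
  {subset s1 <= s2} -> subseq s1 s2.
Proof.
move=> srt1 srt2 sub; have -> : s1 = filter [in s1] s2.
  apply: (irr_sorted_eq ltn_trans ltnn srt1).
    exact/(sorted_filter ltn_trans).
  by move=> x; rewrite mem_filter andb_idr // => /sub.
exact: filter_subseq.
Qed.

Lemma subseq_nth3 (s : seq nat) i j l : i < j < l -> l < size s ->
  subseq [:: nth 0 s i; nth 0 s j; nth 0 s l] s.
Proof.
move=> ltijl ltl; rewrite -{4}[s](mkseq_nth 0).
apply: (map_subseq (nth 0 s) (s1 := [:: i; j; l])).
apply: subseq_sorted_subset; rewrite /= ?iota_ltn_sorted ?andbT //.
by move=> x; rewrite mem_iota !inE; lia.
Qed.

(** * A colouring with many monotone red triples *)

Section Existence.
Variables (k M' : nat).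
Let M := M'.+1.
Implicit Types (s : seq 'I_M) (p : 'I_k * 'I_k).

(* As [i], [j] range over ['I_k], the [k ^ 2] triples of positions [i], [k + j],
   [2 * k + (i + j) %% k] pairwise share no pair of positions. *)
Definition third p := 2 * k + (p.1 + p.2) %% k.

Definition triple s p :=
  let a := nth ord0 s p.1 in let b := nth ord0 s (k + p.2) in
  let c := nth ord0 s (third p) in
  ((a, b), (b, c), (a, c)).

Lemma third_lt p : 2 * k <= third p < 3 * k.
Proof.
have := ltn_pmod (p.1 + p.2) (leq_ltn_trans (leq0n _) (ltn_ord p.1)).
by rewrite /third; lia.
Qed.

(** Addition modulo [k] is a Latin square: two of row, column and entry determine the remaining
    one. *)
Lemma third_inj (p q : 'I_k * 'I_k) : third p = third q -> p.1 = q.1 \/ p.2 = q.2 -> p = q.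
Proof.
case: p q => [i j] [i' j'] /addnI /= /eqP eqm [] eq12; move: eqm; rewrite eq12.
  by rewrite eqn_modDl !modn_small // => /eqP/val_inj ->.
by rewrite eqn_modDr !modn_small // => /eqP/val_inj ->.
Qed.

Lemma triple_uniq s p : uniq s -> size s = 3 * k -> uniq (edges (triple s p)).
Proof.
move=> us szs; have := third_lt p; have := ltn_ord p.1; have := ltn_ord p.2.
move=> lt2 lt1 lt3.
rewrite /edges /= !inE !xpair_eqE !nth_uniq ?szs //; lia.
Qed.

(** The three positions lie in separate blocks of length [k], so a shared pair means agreement in
    two of the first coordinate, the second coordinate and [third], which forces [p = q]. *)
Lemma triple_disjoint s (p q : 'I_k * 'I_k) : uniq s -> size s = 3 * k -> p != q ->
  ~~ has [in edges (triple s p)] (edges (triple s q)).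
Proof.
move=> us szs; have := third_lt p; have := third_lt q.
have := ltn_ord p.1; have := ltn_ord p.2; have := ltn_ord q.1; have := ltn_ord q.2.
move=> ltq2 ltq1 ltp2 ltp1 lt3q lt3p; apply: contra => /hasP[e].
rewrite /edges /= !inE /= => /or3P[] /eqP ->; rewrite !xpair_eqE !nth_uniq ?szs //; try lia.
- case/or3P=> /andP[/eqP e1 /eqP e2]; try lia; apply/eqP.
  rewrite (surjective_pairing p) (surjective_pairing q); congr (_, _); apply/ord_inj.
    exact: esym e1.
  exact/esym/(addnI e2).
- case/or3P=> /andP[/eqP e1 /eqP e2]; try lia; apply/eqP.
  by apply/esym/third_inj => //; right; apply/val_inj/(addnI e1).
- case/or3P=> /andP[/eqP e1 /eqP e2]; try lia; apply/eqP.
  by apply/esym/third_inj => //; left; apply/val_inj.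
Qed.

Definition triples s := [seq triple s p | p <- enum {: 'I_k * 'I_k}].

Lemma card_avoid_triples s : uniq s -> size s = 3 * k ->
  #|avoiders (triples s)| * 8 ^ (k * k) <= 2 ^ (M * M) * 7 ^ (k * k).
Proof.
move=> us szs.
have szt : size (triples s) = k * k by rewrite size_map -cardE card_prod card_ord.
have -> : M * M = #|{: 'I_M * 'I_M}| by rewrite card_prod card_ord.
rewrite -szt; apply: card_avoiders.
  by apply/allP => _ /mapP[p _ ->]; apply: triple_uniq.
rewrite pairwise_map; have := enum_uniq {: 'I_k * 'I_k}; rewrite uniq_pairwise.
by apply: sub_pairwise => p q /= neq; apply: triple_disjoint.
Qed.

(** Union bound: a tuple of [3 * k] distinct labels has no hit triple for at most a fraction
    [(7/8)^(k^2)] of the colourings, and there are at most [M^(3k)] such tuples. The [k]-th power of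
    the hypothesis makes the product less than 1. *)
Lemma exists_mono_dense : 0 < k -> M ^ 3 * 7 ^ k < 8 ^ k ->
  exists phi, mono_dense phi (3 * k) M.
Proof.
move=> k0 ltM.
pose F := {ffun 'I_M * 'I_M -> bool}.
have [phi hit_phi] : exists phi : F,
    [forall s : (3 * k).-tuple 'I_M, uniq s ==> (phi \notin avoiders (triples s))].
  apply/existsP; apply: contraT; rewrite negb_exists => /forallP all_bad.
  have cover : [set: F] \subset
      \bigcup_(s : (3 * k).-tuple 'I_M | uniq s) avoiders (triples s).
    apply/subsetP => phi _; have := all_bad phi; rewrite negb_forall => /existsP[s].
    by rewrite negb_imply negbK => /andP[us av]; apply/bigcupP; exists s.
  have le_sum : 2 ^ (M * M) <= \sum_(s : (3 * k).-tuple 'I_M | uniq s) #|avoiders (triples s)|.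
    have -> : 2 ^ (M * M) = #|[set: F]|.
      by rewrite cardsT card_ffun card_bool card_prod card_ord.
    by apply: leq_trans (subset_leq_card cover) (card_bigcup_le _ _).
  have : 2 ^ (M * M) * 8 ^ (k * k) <= M ^ (3 * k) * (2 ^ (M * M) * 7 ^ (k * k)).
    apply: leq_trans (leq_mul le_sum (leqnn _)) _; rewrite big_distrl /=.
    apply: (@leq_trans (\sum_(s : (3 * k).-tuple 'I_M) 2 ^ (M * M) * 7 ^ (k * k))).
      rewrite [leqRHS](bigID (fun s : (3 * k).-tuple 'I_M => uniq s)) /=.
      apply: leq_trans (leq_addr _ _); apply: leq_sum => s us.
      by rewrite card_avoid_triples ?size_tuple.
    by rewrite sum_nat_const card_tuple card_ord.
  rewrite mulnCA leq_pmul2l ?expn_gt0 // !expnM -expnMn leqNgt.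
  by rewrite ltn_exp2r // ltM.
exists (fun t u => phi (inord t, inord u)) => s srt ltsM le3k.
have st_lt i : i < 3 * k -> nth 0 s i < M.
  by move=> lti; apply: (allP ltsM); rewrite mem_nth ?(leq_trans lti).
(* The list may be longer than [3 * k], so it is truncated; its entries are below [M], where [inord]
   is faithful. *)
pose st : seq 'I_M := map inord (take (3 * k) s).
have szst : size st == 3 * k by rewrite size_map size_takel.
have nth_st i : i < 3 * k -> nth ord0 st i = nth 0 s i :> nat.
  move=> lti; rewrite (nth_map 0) ?size_takel // nth_take // inordK //.
  exact: st_lt.
have us : uniq (Tuple szst).
  have: uniq (take (3 * k) s).
    apply/take_uniq/(sorted_uniq _ _ srt) => [a b c /= lt1 lt2|a]; last exact: ltnn.
    exact: ltn_trans lt2 lt1.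
  rewrite /= map_inj_in_uniq // => a b as_ bs eqab.
  have lts x : x \in take (3 * k) s -> x < M by move/mem_take/(allP ltsM).
  by have := congr1 (@nat_of_ord M) eqab; rewrite /= !inordK ?lts.
have := implyP (forallP hit_phi (Tuple szst)) us; rewrite inE -has_predC.
case/hasP=> _ /mapP[[i j] _ ->]; rewrite /= negbK => hit.
have lt3 := third_lt (i, j); have lti := ltn_ord i; have ltj := ltn_ord j.
exists (nth 0 s i), (nth 0 s (k + j)), (nth 0 s (third (i, j))).
clear ltM; split; first by apply: subseq_nth3; lia.
move: hit; rewrite /hits /mono_red /= -!nth_st ?inord_val //; try lia.
by case/andP: lt3.
Qed.
End Existence.

(** * The hypergraph: no clique on five vertices, no large independent set *)

Section Hypergraph.
Variables (phi : nat -> nat -> bool) (N : nat).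

Definition red_seq (s : seq nat) :=
  if s is [:: v1; v2; v3; v4] then red phi (delta v1 v2) (delta v2 v3) (delta v3 v4)
  else false.

Definition vertices (e : {set 'I_N}) : seq nat := map val (enum e).

Definition red_edges : {set {set 'I_N}} := [set e | red_seq (vertices e)].

Lemma vertices_sorted e : sorted ltn (vertices e).
Proof.
rewrite /vertices -[map _ _]/(map val _); apply: subseq_sorted (iota_ltn_sorted 0 N).
  exact: ltn_trans.
by rewrite -val_enum_ord map_subseq // enumT /enum_mem filter_subseq.
Qed.

Lemma size_vertices e : size (vertices e) = #|e|.
Proof. by rewrite size_map -cardE. Qed.

Lemma mem_vertices (e : {set 'I_N}) (x : 'I_N) : (val x \in vertices e) = (x \in e).
Proof. by rewrite mem_map ?mem_enum //; apply: val_inj. Qed.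

Lemma vertices_of (s : seq 'I_N) :
  sorted ltn (map val s) -> vertices [set x in s] = map val s.
Proof.
move=> srt; apply: (irr_sorted_eq ltn_trans ltnn) => //; first exact: vertices_sorted.
move=> x; apply/mapP/mapP => -[y ys ->]; exists y => //; move: ys.
  by rewrite mem_enum inE.
by rewrite mem_enum inE.
Qed.

Lemma red_edges_uniform : uniform 4 red_edges.
Proof.
apply/forallP => e; apply/implyP; rewrite inE -size_vertices.
by case: (vertices e) => [|v1 [|v2 [|v3 [|v4 [|]]]]].
Qed.

Lemma edge_of (S : {set 'I_N}) v1 v2 v3 v4 :
    subseq [:: v1; v2; v3; v4] (vertices S) ->
  exists e : {set 'I_N}, [/\ e \subset S, #|e| = 4 &
    (e \in red_edges) = red phi (delta v1 v2) (delta v2 v3) (delta v3 v4)].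
Proof.
move=> sub; have srt := subseq_sorted ltn_trans sub (vertices_sorted S).
have [s def_s] : exists s : seq 'I_N, [:: v1; v2; v3; v4] = map val s.
  case/subseqP: sub => b _ ->; exists (mask b (enum S)).
  by rewrite map_mask.
exists [set x in s]; have eqv : vertices [set x in s] = [:: v1; v2; v3; v4].
  by rewrite vertices_of -?def_s.
split; last by rewrite inE eqv.
  apply/subsetP => x; rewrite -!mem_vertices eqv; exact: (mem_subseq sub).
by rewrite -size_vertices eqv.
Qed.

Lemma red_edges_no_clique : ~ has_clique 4 5 red_edges.
Proof.
move=> [S [cardS clique]].
have [v1 [v2 [v3 [v4 [v5 def_S]]]]] : exists v1 v2 v3 v4 v5, vertices S = [:: v1; v2; v3; v4; v5].
  have := size_vertices S; rewrite cardS.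
  case: (vertices S) => [|v1 [|v2 [|v3 [|v4 [|v5 [|//]]]]]] // _.
  by exists v1, v2, v3, v4, v5.
have srt := vertices_sorted S; rewrite def_S /= andbT in srt.
have /and4P[lt12 lt23 lt34 lt45] := srt.
have redS u1 u2 u3 u4 : subseq [:: u1; u2; u3; u4] (vertices S) ->
    red phi (delta u1 u2) (delta u2 u3) (delta u3 u4).
  by move=> /edge_of[e [eS e4 <-]]; apply: clique.
have := @no_red_five phi (delta v1 v2) (delta v2 v3) (delta v3 v4) (delta v4 v5).
(* The maxima become deltas across an omitted inner vertex. *)
rewrite -(delta_max lt12 lt23) -(delta_max lt23 lt34) -(delta_max lt34 lt45).
have lt13 := ltn_trans lt12 lt23; have lt24 := ltn_trans lt23 lt34.
rewrite !delta_neq //.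
move=> /(_ isT isT isT isT isT) /negP[]; rewrite !redS // def_S.
all: by rewrite /= ?(gtn_eqF lt12, gtn_eqF lt23, gtn_eqF lt34, gtn_eqF lt45, eqxx).
Qed.

Lemma red_edges_no_indep m M n : mono_dense phi m M -> 0 < M -> N <= 2 ^ M.-1 ->
  2 * (2 * m) ^ 5 < n -> ~ has_indep n red_edges.
Proof.
move=> dense M0 leN lt_n [S [cardS indep]].
have size_S : size (vertices S) = n by rewrite size_vertices.
have ltS x : x \in vertices S -> x < 2 ^ M.-1.
  by case/mapP=> y _ ->; apply: leq_trans (ltn_ord y) leN.
have [T [wT lT]] : exists T, well_labelled T /\ leaves T = vertices S.
  apply: (@tree_of_sorted M.-1); last 1 first.
  - by move=> x y /ltS ltx /ltS lty; rewrite !divn_small.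
  - by rewrite -size_eq0 size_S; lia.
  - exact: vertices_sorted.
suff: size (leaves T) <= 2 * (2 * m) ^ 5 by rewrite lT size_S leqNgt lt_n.
apply: (size_leaves_le wT _ dense) => //; rewrite lT //.
move=> v1 v2 v3 v4 v1S v2S v3S v4S lt12 lt23 lt34.
apply/negP => redv.
have sub : subseq [:: v1; v2; v3; v4] (vertices S).
  apply: subseq_sorted_subset; rewrite /= ?lt12 ?lt23 ?lt34 ?vertices_sorted //.
  by move=> x; rewrite !inE => /or4P[] /eqP->.
have [e [eS _ e_red]] := edge_of sub.
by have := indep e; rewrite e_red redv eS => /(_ isT).
Qed.
End Hypergraph.

(** * Choice of the parameters *)

(** For positive [a] this is [(1 + 1/a)^n >= 1 + n/a] with denominators cleared. *)
Lemma bernoulli a n : a ^ n * (a + n) <= a * a.+1 ^ n.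
Proof.
elim: n => [|n IHn]; first by rewrite !expn0 addn0 mul1n muln1.
have le_a : a * (a + n.+1) <= a.+1 * (a + n).
  by rewrite addnS mulnS mulSn leq_add2r leq_addr.
rewrite !expnS; apply: leq_trans (_ : a.+1 * (a ^ n * (a + n)) <= _).
  by rewrite mulnAC mulnC [leqRHS]mulnCA leq_mul2l le_a orbT.
by rewrite [leqRHS]mulnCA leq_mul2l IHn orbT.
Qed.

(** The seventh power of [(1 + 1/a)^a >= 2] exceeds [2^6]. *)
Lemma expn_succ_gap a : 0 < a -> 2 ^ 6 * a ^ (a * 7) < a.+1 ^ (a * 7).
Proof.
move=> a0; have le2 : 2 * a ^ a <= a.+1 ^ a.
  by rewrite -(leq_pmul2l a0) (leq_trans _ (bernoulli a a)) // addnn -mul2n mulnCA mulnA mulnC.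
apply: leq_trans (_ : (2 * a ^ a) ^ 7 <= _).
  by rewrite expnMn -expnM ltn_pmul2r ?ltn_exp2l // expn_gt0 a0.
by rewrite [a.+1 ^ _]expnM leq_exp2r.
Qed.

(** The parameters are [M = 4^j], [k = 49 j] and [m = 3 k = 147 j], whence [294 j = 2 m]. The
    condition [M^3 * 7^k < 8^k] is the [j]-th power of [2^6 * 7^49 < 8^49]. *)
Lemma not_ramsey j n N : 0 < j -> N <= 2 ^ 2 ^ j -> 2 * (294 * j) ^ 5 < n ->
  ~ ramsey_prop 4 5 n N.
Proof.
move=> j0 leN lt_n ramsey.
have M0 : 0 < 2 ^ (2 * j) by rewrite expn_gt0.
have [phi dense] : exists phi, mono_dense phi (3 * (49 * j)) (2 ^ (2 * j)).
  rewrite -(prednK M0); apply: exists_mono_dense; first by rewrite muln_gt0.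
  rewrite (prednK M0) -expnM -mulnA [j * 3]mulnC mulnA (expnM 2 (2 * 3)).
  rewrite (expnM 7) (expnM 8) -expnMn (ltn_exp2r _ _ j0).
  exact: (@expn_succ_gap 7 isT).
case: (ramsey _ (red_edges_uniform phi N)); first exact: red_edges_no_clique.
apply: (red_edges_no_indep dense) => //.
  (* As [0 < j], [2 ^ j] is strictly less than [M], hence at most [M.-1]. *)
  rewrite (leq_trans leN) // leq_exp2l // -ltnS prednK //.
  by rewrite ltn_exp2l // -[ltnLHS]mul1n ltn_pmul2r.
by have -> : 2 * (3 * (49 * j)) = 294 * j by lia.
Qed.

(** This serves the case [b = 1], where [2 ^ 2 ^ b = 4]. For the empty hypergraph either alternative
    supplies at least five vertices. *)
Lemma ramsey_ge4 n N : 5 <= n -> ramsey_prop 4 5 n N -> 4 <= N.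
Proof.
move=> n5 ramsey; have : uniform 4 (set0 : {set {set 'I_N}}).
  by apply/forallP => e; rewrite inE.
case/ramsey => -[S [cardS _]]; have := max_card (mem S); rewrite card_ord.
  by rewrite cardS; lia.
by rewrite cardS; lia.
Qed.

(** Take the least [j] with [n <= 2 * (294 * j.+1) ^ 5], and [b = j], or [b = 1] if [j = 0]. For
    positive [j] minimality gives [2 * (294 * j) ^ 5 < n], as [not_ramsey] requires. Since
    [j.+1 <= 2 * b] and [2 * 2^5 <= 3^5], the constant becomes [882 = 3 * 294]. *)
Lemma ramsey_large n N : 5 <= n -> ramsey_prop 4 5 n N ->
  exists b, [/\ 0 < b, n <= (882 * b) ^ 5 & 2 ^ 2 ^ b <= N].
Proof.
move=> n5 ramsey.
pose bound a j := 2 * (a * j.+1) ^ 5.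
have bound_ge a j : 0 < a -> j < bound a j.
  move=> a0; rewrite /bound (leq_trans _ (leq_pmull _ (ltn0Sn 1))) //.
  rewrite (leq_trans (leq_pmull j.+1 a0)) // -[leqLHS]expn1 leq_pexp2l //.
  by rewrite muln_gt0 a0.
have bound_le a b j : j < 2 * b -> bound a j <= (a * 3 * b) ^ 5.
  move=> ltj; apply: leq_trans (_ : 2 * (a * (2 * b)) ^ 5 <= _).
    by rewrite leq_mul // leq_exp2r // leq_mul.
  have: 2 * 2 ^ 5 <= 3 ^ 5 by [].
  rewrite !expnMn; move: (2 ^ 5) (3 ^ 5) (a ^ 5) (b ^ 5) => p q A B le_pq.
  by rewrite mulnCA (mulnA 2) -(mulnA A) !leq_mul.
have ex_j : exists j, n <= bound 294 j by exists n; apply/ltnW/bound_ge.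
case: (ex_minnP ex_j) => j le_n min_j.
have [j0|j_gt0] := posnP j.
  exists 1; split; [by [] | | exact: ramsey_ge4 ramsey].
  by apply: leq_trans le_n (bound_le 294 1 j _); rewrite j0.
exists j; split; first exact: j_gt0.
  by apply: leq_trans le_n (bound_le 294 j j _); rewrite mul2n -addnn -addn1 leq_add2l.
rewrite leqNgt; apply/negP => /ltnW leN; apply: (not_ramsey j_gt0 leN) ramsey.
rewrite ltnNge; apply/negP => le_n'.
have := min_j j.-1; rewrite /bound (prednK j_gt0) => /(_ le_n').
by rewrite leqNgt prednK // leqnn.
Qed.

(* Passage to real exponents *)
From Stdlib Require Import Reals Lra.

Lemma INR_expn m n : INR (expn m n) = (INR m ^ n)%R.
Proof. by elim: n => [|n IHn] //; rewrite expnS mult_INR IHn. Qed.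

Lemma Rpower2_INR n : Rpower 2 (INR n) = INR (expn 2 n).
Proof. by rewrite Rpower_pow ?INR_expn //; lra. Qed.

Theorem theorem1p2 :
  exists c : R, (0 < c)%R /\
    forall n : nat, (5 <= n)%N ->
      ramsey_ge 4 5 n (Rpower 2 (Rpower 2 (c * Rpower (INR n) (1/5)))).
Proof.
(* The bound [n <= (882 * b) ^ 5] reads [n^(1/5) / 882 <= b], which dictates the constant. *)
exists (/ INR 882)%R; have c0 : (0 < INR 882)%R by apply/lt_0_INR/ltP.
split=> [|n n5 N ramsey]; first exact: Rinv_0_lt_compat.
have [b [b0 le_n le_N]] := ramsey_large n5 ramsey.
have n0 : (0 < INR n)%R by apply/lt_0_INR/ltP; apply: leq_trans n5.
have root_n : (Rpower (INR n) (1 / 5) <= INR 882 * INR b)%R.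
  have b882 : (0 < INR (882 * b))%R by apply/lt_0_INR/ltP; rewrite muln_gt0.
  have root_b : Rpower (INR (expn (882 * b) 5)) (1 / 5) = INR (882 * b).
    have inv5 : (INR 5 * (1 / 5) = 1)%R by rewrite /=; lra.
    by rewrite INR_expn -Rpower_pow // Rpower_mult inv5 Rpower_1.
  rewrite -mult_INR -root_b.
  apply: Rle_Rpower_l; first by lra.
  by split=> //; apply/le_INR/leP.
apply: Rle_trans (le_INR _ _ (elimT leP le_N)).
rewrite -2!Rpower2_INR; apply: Rle_Rpower; first by lra.
apply: Rle_Rpower; first by lra.
apply: (Rmult_le_reg_l (INR 882)) => //.
by rewrite -Rmult_assoc Rinv_r ?Rmult_1_l //; lra.
Qed.
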